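(* Fix $\lambda_1,\lambda_2\in\Lambda$ and $l>0$. Let $h_1,h_2\in\mathbb R^n$ be such that $\|h_1\|_\infty,\|h_2\|_\infty\le l$, and let $$m=\big(\overline c+l+|\lambda_1|\vee|\lambda_2|\big)\max\Big\{\frac1{1-\bar\eta},\ \frac{1-\chi(l+|\lambda_1|\vee|\lambda_2|)^{n-1}}{1-\chi(l+|\lambda_1|\vee|\lambda_2|)}\Big\}.$$ Then $$\|G(h_1,\lambda_1)-G(h_2,\lambda_2)\|_m\le\beta_m\|h_1-h_2\|_m+\Delta^m|\lambda_1-\lambda_2|,$$ where $\Delta^m=\max_{1\le i\le n}\Delta_i^m$ and $\{\Delta_i^m\}_{1\le i\le n}$ is defined recursively by $$\Delta_1^m=\frac1{w_1^m},\qquad\Delta_i^m=\frac{1+\max_{1\le j\le i-1}\Delta_j^m}{w_i^m},\quad2\le i\le n.$$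
   Context: Setting. $S=\{1,\dots,n\}$ is a finite state space with reference state $n$; for each $i\in S$, $\mathbb U(i)$ is a compact metric space; $S_{\mathbb U}=\{(i,u):i\in S,\ u\in\mathbb U(i)\}$. $p(i,j,u)$ are controlled transition probabilities ($p\ge0$, $\sum_jp(i,j,u)=1$), $c:S_{\mathbb U}\to[0,\infty)$ is the running cost, $\delta>0$ is the risk-sensitivity parameter, $\overline c=\max_{S_{\mathbb U}}c$. A stationary Markov policy is a map $v$ with $v(i)\in\mathbb U(i)$; under $v$ the process $X$ is the Markov chain on $S$ with transition probabilities $p(i,j,v(i))$. Standing assumption: for all $i,j$, $u\mapsto c(i,u)$ and $u\mapsto p(i,j,u)$ are continuous on $\mathbb U(i)$, and $X$ is irreducible under every stationary Markov policy. Operator. For $h\in\mathbb R^n$, $\lambda\in\mathbb R$, $G(h,\lambda)\in\mathbb R^n$ is defined recursively in $i=1,\dots,n$ by $$G_i(h,\lambda)=\min_{u\in\mathbb U(i)}\Big[\delta c(i,u)+\log\Big(p(i,n,u)+\sum_{j=1}^{i-1}e^{G_j(h,\lambda)}p(i,j,u)+\sum_{j=i}^{n-1}e^{h(j)}p(i,j,u)\Big)\Big]-\lambda$$ (first sum empty for $i=1$). $\Lambda$ is the set of $\lambda\in\mathbb R$ for which a fixed point $V=\widetilde F(V,\lambda)$ exists and is finite, where for $V\in\mathbb R^n$ $$\widetilde F_i(V,\lambda)=\min_{u\in\mathbb U(i)}\Big[e^{\delta c(i,u)-\lambda}\Big(p(i,n,u)+\sum_{j=1}^{n-1}V(j)p(i,j,u)\Big)\Big],\quad1\le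 i\le n.$$ Weighted norm. $\overline p(i,j)=\inf_{u\in\mathbb U(i)}p(i,j,u)$ and $\eta=\min\{\overline p(i,j):\overline p(i,j)>0,\ i,j\in S\}$, which the paper takes to lie in $(0,1)$. $S_1=\{n\}$ and, for $k>1$, $S_k=\{i\in S:i\notin\bigcup_{r\le k-1}S_r,\ \min_{u\in\mathbb U(i)}\max_{j\in S_1\cup\dots\cup S_{k-1}}p(i,j,u)>0\}$; these form a finite partition of $S$; let $l_0$ be the number of sets in the partition and $k(i)$ the index with $i\in S_{k(i)}$. For $m>0$, $w_n^m=1$, $w_i^m=1-(\eta e^{-2m})^{2k(i)}$ for $i<n$, $\beta_m=\frac{1-(\eta e^{-2m})^{2l_0-1}}{1-(\eta e^{-2m})^{2l_0}}$, and $\|x\|_m=\max_{1\le i\le n}|x_i|/w_i^m$. $\|\cdot\|_\infty$ is the supremum norm and $a\vee b=\max\{a,b\}$. Constants. $\bar\eta=1-(n-1)\eta$, which the paper takes to lie in $(0,1)$; for $r\ge0$, $$\chi(r)=\max_{(i,u)\in S_{\mathbb U}}\frac{(1-p(i,n,u))\,e^{\overline c+r}}{p(i,n,u)+(1-p(i,n,u))\,e^{\overline c+r}},$$ which the paper takes to be less than $1$ for every $r>0$. *)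

(* Defs.v *)
From HB Require Import structures.
From mathcomp Require Import all_boot all_order all_algebra.
From mathcomp Require Import all_classical all_reals all_analysis.

Set Implicit Arguments.
Unset Strict Implicit.
Unset Printing Implicit Defensive.

Import Order.TTheory GRing.Theory Num.Theory.
Import numFieldNormedType.Exports.

Local Open Scope classical_set_scope.
Local Open Scope ring_scope.

(* The state space {1, ..., n} is 'I_N.+1 with n = N.+1: state i is the
   ordinal of value i - 1, and the reference state n is ord_max.  Hence
   1 <= j <= n - 1 reads (j < N)%N, and n - 1 itself is N. *)

(* A vector x with x 0 i = F x i, when F x i only reads the entries of x of
   index < i; see recursive_vectorE. *)
Definition recursive_vector (R : realType) (N : nat)
    (F : 'rV[R]_N.+1 -> 'I_N.+1 -> R) : 'rV[R]_N.+1 :=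
  iter N.+1 (fun x => \row_i F x i) 0.

Lemma recursive_vectorE (R : realType) (N : nat)
    (F : 'rV[R]_N.+1 -> 'I_N.+1 -> R) (i : 'I_N.+1) :
  (forall (i : 'I_N.+1) (x y : 'rV[R]_N.+1),
      (forall j : 'I_N.+1, (j < i)%N -> x 0 j = y 0 j) -> F x i = F y i) ->
  recursive_vector F 0 i = F (recursive_vector F) i.
Proof.
move=> HF; pose g k := iter k (fun x => \row_i F x i) (0 : 'rV[R]_N.+1).
suff H : forall k (j : 'I_N.+1), (j < k)%N -> g k.+1 0 j = g k 0 j.
  by rewrite -[recursive_vector F]/(g N.+1) -(H _ _ (ltn_ord i)) -[g N.+2]/(\row_i F (g N.+1) i) mxE.
elim=> [//|k IH] j jk.
rewrite -[g k.+1 in RHS]/(\row_i F (g k) i) -[g k.+2]/(\row_i F (g k.+1) i) !mxE.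
by apply: HF => l lj; apply: IH; rewrite (leq_trans lj).
Qed.

Section min_max.
Variable R : realType.

(* min over T; a genuine minimum for compact T and continuous f, see umin_attained *)
Definition umin (T : Type) (f : T -> R) : R := inf (range f).

Lemma umin_attained (T : topologicalType) (f : T -> R) :
  compact [set: T] -> [set: T] !=set0 -> continuous f ->
  exists u, umin f = f u /\ forall u', f u <= f u'.
Proof.
move=> cT T0 cf.
have [u _ fu] := @compact_EVT_min T R f setT T0 cT (continuous_subspaceT cf).
have fle u' : f u <= f u' by apply: fu; rewrite inE.
exists u; split=> //; apply/eqP; rewrite eq_le; apply/andP; split.
  by apply: ge_inf; [exists (f u) => _ [u' _ <-]; exact: fle | exists u].
by apply: lb_le_inf; [exists (f u), u | move=> _ [u' _ <-]; exact: fle].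
Qed.

(* max over the state-action pairs {(i, u) | u \in U i} *)
Definition max_pairs (I : Type) (U : I -> Type) (f : forall i, U i -> R) : R :=
  sup [set x | exists (i : I) (u : U i), x = f i u].

End min_max.

Section controlled_chain.
Variables (R : realType) (N : nat) (U : 'I_N.+1 -> metricType R).
Variable p : forall i : 'I_N.+1, 'I_N.+1 -> U i -> R.
Variable c : forall i : 'I_N.+1, U i -> R.
Variable delta : R.

Definition controlled_stochastic : Prop :=
  forall i (u : U i), (forall j, 0 <= p j u) /\ \sum_j p j u = 1.

Definition irreducible_mx (P : 'M[R]_N.+1) : Prop :=
  forall i j, exists k : nat, 0 < (P ^+ k) i j.

Definition policy_mx (v : forall i, U i) : 'M[R]_N.+1 :=
  \matrix_(i, j) p j (v i).

Definition cbar : R := max_pairs c.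

Definition G_step (h : 'rV[R]_N.+1) (lam : R) (g : 'rV[R]_N.+1) (i : 'I_N.+1) : R :=
  umin (fun u : U i => delta * c u +
    ln (p ord_max u
        + \sum_(j < N.+1 | (j < i)%N) expR (g 0 j) * p j u
        + \sum_(j < N.+1 | (i <= j < N)%N) expR (h 0 j) * p j u)) - lam.

Definition G (h : 'rV[R]_N.+1) (lam : R) : 'rV[R]_N.+1 :=
  recursive_vector (G_step h lam).

Lemma GE h lam i :
  G h lam 0 i = umin (fun u : U i => delta * c u +
    ln (p ord_max u
        + \sum_(j < N.+1 | (j < i)%N) expR (G h lam 0 j) * p j u
        + \sum_(j < N.+1 | (i <= j < N)%N) expR (h 0 j) * p j u)) - lam.
Proof.
rewrite /G recursive_vectorE // => {}i x y xy; rewrite /G_step; congr (umin _ - _).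
apply/funext => u; congr (_ + ln (_ + _ + _)).
by apply: eq_bigr => j ji; rewrite xy.
Qed.

Definition Ftilde (V : 'rV[R]_N.+1) (lam : R) : 'rV[R]_N.+1 :=
  \row_i umin (fun u : U i => expR (delta * c u - lam) *
    (p ord_max u + \sum_(j < N.+1 | (j < N)%N) V 0 j * p j u)).

Definition Lambda : set R :=
  [set lam | exists V : 'rV[R]_N.+1, V = Ftilde V lam].

Definition pbar (i j : 'I_N.+1) : R := inf (range (fun u : U i => p j u)).

(* infimum of a finite set, hence a minimum as soon as the set is nonempty *)
Definition eta_min : R := inf [set x | exists i j, x = pbar i j /\ 0 < x].

Definition next_layer (T : {set 'I_N.+1}) : {set 'I_N.+1} :=
  [set i : 'I_N.+1 | (i \notin T) &&
     (0 < umin (fun u : U i => \big[Num.max/0]_(j in T) p j u))]%SET.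

(* The layers are numbered from 1, starting with {n}; reached k is the union of
   the layers 1, ..., k, see reachedE. *)
Fixpoint reached (k : nat) : {set 'I_N.+1} :=
  match k with
  | 0 => finset.set0
  | 1 => [set ord_max]
  | k'.+1 => reached k' :|: next_layer (reached k')
  end%SET.

Definition layer (k : nat) : {set 'I_N.+1} :=
  match k with
  | 0 => finset.set0
  | 1 => [set ord_max]
  | k'.+1 => next_layer (reached k')
  end%SET.

Lemma reachedE k : reached k = (\bigcup_(1 <= r < k.+1) layer r)%SET.
Proof.
elim: k => [|[|k] IH]; first by rewrite big_geq.
  by rewrite big_nat1.
by rewrite big_nat_recr //= -IH.
Qed.

(* The nonempty layers are pairwise disjoint and consecutive, so they all have
   index at most N.+1; layer 0 is empty and is not counted. *)
Definition l0 : nat := #|[set k : 'I_N.+2 | layer k != finset.set0]%SET|.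

Definition layer_index (i : 'I_N.+1) : nat :=
  find (fun k => i \in layer k) (iota 0 N.+2).

Definition weight (m : R) (i : 'I_N.+1) : R :=
  if i == ord_max then 1
  else 1 - (eta_min * expR (- 2 * m)) ^+ (2 * layer_index i).

Definition beta_coef (m : R) : R :=
  (1 - (eta_min * expR (- 2 * m)) ^+ (2 * l0 - 1)) /
  (1 - (eta_min * expR (- 2 * m)) ^+ (2 * l0)).

(* The neutral element 0 of the iterated maximum is harmless: the weights are
   positive when eta_min < 1 and 0 < m.  The same holds for Delta below. *)
Definition wnorm (m : R) (x : 'rV[R]_N.+1) : R :=
  \big[Num.max/0]_i (`|x 0 i| / weight m i).

Definition etabar : R := 1 - N%:R * eta_min.

Definition chi_max (r : R) : R :=
  max_pairs (fun i (u : U i) =>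
    ((1 - p ord_max u) * expR (cbar + r)) /
    (p ord_max u + (1 - p ord_max u) * expR (cbar + r))).

Definition Delta_step (m : R) (D : 'rV[R]_N.+1) (i : 'I_N.+1) : R :=
  if i == ord0 then 1 / weight m i
  else (1 + \big[Num.max/0]_(j < N.+1 | (j < i)%N) D 0 j) / weight m i.

Definition Delta_vec (m : R) : 'rV[R]_N.+1 := recursive_vector (Delta_step m).

Lemma Delta_vecE m i :
  Delta_vec m 0 i =
  if i == ord0 then 1 / weight m i
  else (1 + \big[Num.max/0]_(j < N.+1 | (j < i)%N) Delta_vec m 0 j) / weight m i.
Proof.
rewrite /Delta_vec recursive_vectorE // => {}i x y xy; rewrite /Delta_step.
by case: ifP => // _; congr ((1 + _) / _); apply: eq_bigr => j /xy.
Qed.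

Definition Delta (m : R) : R := \big[Num.max/0]_i Delta_vec m 0 i.

End controlled_chain.

(* Main.v *)
Require Import Defs.
From HB Require Import structures.
From mathcomp Require Import all_boot all_order all_algebra.
From mathcomp Require Import all_classical all_reals all_analysis.
From mathcomp Require Import ring lra.

(** Since chi < 1, every state jumps to the reference state n with positive
    probability under every action, and by compactness that probability is at
    least eta (chi_max_lt1_pmax_gt0, eta_min_le).  The layers therefore reduce
    to S_1 = {n} and S_2 = everything else; so, with e = eta exp(-2m), all
    weights of states i < n equal w = 1 - e^4, the weight of n is 1, and
    beta_m = (1 - e^3) / (1 - e^4) (layer_index_eq2, l0_eq2).

    The sweep defining G is of Gauss-Seidel type: at state i it reads the values
    already updated at j < i, and the old values h(j) at i <= j < n.  Write
    y for the old part of the sum inside the logarithm, and a for the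
    probability p(i,n,u), whose exponent is pinned to 0.  The updated
    values already carry the contracted discrepancy beta w H, where H is the
    weighted distance of h1 and h2, whereas the old values carry w H.  To find
    beta w H again at state i it is enough that the pinned mass a slows down the
    old part, that is y <= beta (a + y): by convexity of exp,
    a + y exp(-d) >= (a + y) exp(-beta d) (two_point_jensen,
    ln_sum_expR_contract).  This balance involves h alone and not the values of
    G: since y <= exp(l) <= exp(m) and a >= eta, it holds because beta is so
    close to 1 (gauss_seidel_margin); l <= m because 1 - etabar < 1.

    Changing lambda adds |lambda1 - lambda2| at each state to the largest
    discrepancy inherited from earlier states, and weight times Delta is
    precisely this accumulation (Delta_vec_weight).  Strong induction on the
    state gives the coordinatewise bound (G_weighted_le). *)

Set Implicit Arguments.
Unset Strict Implicit.
Unset Printing Implicit Defensive.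

Import Order.TTheory GRing.Theory Num.Theory.
Import numFieldNormedType.Exports.

Local Open Scope classical_set_scope.
Local Open Scope ring_scope.

(** * Elementary estimates *)

Section elementary_estimates.
Variable R : realType.

(** An unbounded set is included: its supremum is 0 by convention. *)
Lemma sup_nonneg (A : set R) : (forall x, A x -> 0 <= x) -> 0 <= sup A.
Proof.
move=> A_ge0; have [supA|/sup_out->//] := pselect (has_sup A).
by have [[x Ax] ubA] := supA; apply: le_trans (ub_le_sup ubA Ax); exact: A_ge0.
Qed.

(** The lower bound b on f replaces compactness: umin is an infimum, so its
    defining inequalities are available as soon as f is bounded below. *)
Lemma le_uminD (T : Type) (f g : T -> R) (b t : R) :
  [set: T] !=set0 -> (forall u, b <= f u) -> (forall u, f u <= g u + t) ->
  umin f <= umin g + t.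
Proof.
move=> [u0 _] b_le f_le; rewrite -lerBlDr; apply: lb_le_inf; first by exists (g u0), u0.
move=> _ [u _ <-]; rewrite lerBlDr; apply: le_trans (f_le u).
by apply: ge_inf; [exists b => _ [v _ <-] | exists u].
Qed.

(** Convexity of exp at the weighted mean of 0 and - d, with weights a and y.
    The mean is y / (a + y) * d, which the hypothesis bounds by b * d; this form
    avoids the division.  After multiplication by exp (b * d), the tangent line
    inequality exp x >= 1 + x suffices. *)
Lemma two_point_jensen (a y b d : R) : 0 <= a -> 0 <= y -> 0 <= d ->
  y <= b * (a + y) -> (a + y) * expR (- (b * d)) <= a + y * expR (- d).
Proof.
move=> a_ge0 y_ge0 d_ge0 y_le.
have -> : a + y * expR (- d)
    = (a * expR (b * d) + y * expR (b * d - d)) * expR (- (b * d)).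
  rewrite mulrDl -!mulrA -!expRD subrr expR0 mulr1; congr (_ + _ * expR _); ring.
rewrite ler_pM2r ?expR_gt0//.
have h1 := ler_wpM2l a_ge0 (expR_ge1Dx (b * d)).
have h2 := ler_wpM2l y_ge0 (expR_ge1Dx (b * d - d)).
have := ler_wpM2r d_ge0 y_le; lra.
Qed.

(** One Gauss-Seidel update at a fixed action.  The discrepancies are t on the
    updated indices P, d on the old indices Q, and 0 on the mass a.  The mass a
    damps the old part so that d counts only for b * d <= t, whence t bounds the
    whole change of the logarithm. *)
Lemma ln_sum_expR_contract (I : finType) (P Q : pred I) (q g1 g2 h1 h2 : I -> R)
    (a b d t : R) :
  (forall j, 0 <= q j) -> 0 < a -> 0 <= d -> b * d <= t ->
  (forall j, P j -> g1 j <= g2 j + t) ->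
  (forall j, Q j -> h1 j <= h2 j + d) ->
  \sum_(j | Q j) expR (h1 j) * q j
    <= b * (a + \sum_(j | Q j) expR (h1 j) * q j) ->
  ln (a + \sum_(j | P j) expR (g1 j) * q j + \sum_(j | Q j) expR (h1 j) * q j)
    <= ln (a + \sum_(j | P j) expR (g2 j) * q j
             + \sum_(j | Q j) expR (h2 j) * q j) + t.
Proof.
move=> q_ge0 a_gt0 d_ge0 bd_le g_le h_le.
have sum_ge0 (S : pred I) (x : I -> R) : 0 <= \sum_(j | S j) expR (x j) * q j.
  by apply: sumr_ge0 => j _; rewrite mulr_ge0 ?expR_ge0.
have sum_le (S : pred I) (x y : I -> R) (s : R) :
    (forall j, S j -> x j <= y j + s) ->
    (\sum_(j | S j) expR (x j) * q j) * expR (- s) <= \sum_(j | S j) expR (y j) * q j.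
  move=> xy; rewrite mulr_suml; apply: ler_sum => j /xy xyj.
  rewrite mulrAC -expRD ler_wpM2r// ler_expR; lra.
move: (sum_le P g1 g2 t g_le) (sum_le Q h1 h2 d h_le).
move: (sum_ge0 P g1) (sum_ge0 P g2) (sum_ge0 Q h1) (sum_ge0 Q h2).
set x1 := \sum_(j | P j) _; set x2 := \sum_(j | P j) _.
set y1 := \sum_(j | Q j) _; set y2 := \sum_(j | Q j) _.
move=> x1_ge0 x2_ge0 y1_ge0 y2_ge0 x_le y_le yb.
have jensen := two_point_jensen (ltW a_gt0) y1_ge0 d_ge0 yb.
have shrink : (a + y1) * expR (- t) <= (a + y1) * expR (- (b * d)).
  rewrite ler_wpM2l ?ler_expR; lra.
have z_le : (a + x1 + y1) * expR (- t) <= a + x2 + y2 by lra.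
rewrite -lerBlDr -[- t](expRK (- t)) -lnM ?posrE ?expR_gt0//; last by lra.
by rewrite ler_ln// posrE ?mulr_gt0 ?expR_gt0//; lra.
Qed.

(** Clearing denominators, the claim is e^3 (1 - e) y <= (1 - e^3) a.  One factor
    e absorbs y, because e y <= eta exp(-m) exp(m) <= a; the other factors only
    help, as e < 1. *)
Lemma gauss_seidel_margin (eta m y a e : R) :
  0 < eta < 1 -> eta <= a -> 0 <= y -> y <= expR m -> 0 <= m ->
  e = eta * expR (- 2 * m) ->
  y <= (1 - e ^+ 3) / (1 - e ^+ 4) * (a + y).
Proof.
move=> /andP[eta_gt0 eta_lt1] a_ge y_ge0 y_le m_ge0 eE.
have e_gt0 : 0 < e by rewrite eE mulr_gt0 ?expR_gt0.
have em_le1 : expR (- m) <= 1 by rewrite expR_le1; lra.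
have e_le : e <= eta * expR (- m).
  by rewrite eE ler_pM2l// ler_expR; lra.
have e_lt1 : e < 1.
  apply: le_lt_trans e_le _; have := expR_gt0 (- m); nra.
have ey : e * y <= a.
  apply: le_trans a_ge; apply: le_trans (ler_pM (ltW e_gt0) y_ge0 e_le y_le) _.
  by rewrite -mulrA -expRD addNr expR0 mulr1.
have e4_lt1 : 0 < 1 - e ^+ 4 by rewrite subr_gt0 exprn_ilt1 ?ltW.
rewrite mulrAC ler_pdivlMr//.
have e2_gt0 : 0 < e ^+ 2 by rewrite exprn_gt0.
have e2_le1 : e ^+ 2 <= 1 by rewrite exprn_ile1 ?ltW.
have k1 : e ^+ 2 * (1 - e) * (e * y) <= e ^+ 2 * (1 - e) * a.
  by rewrite ler_wpM2l// mulr_ge0; lra.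
have k2 : e ^+ 2 * ((1 - e) * a) <= (1 - e) * a.
  by rewrite ler_piMl// mulr_ge0; lra.
have k3 : (1 - e) * a <= (1 - e ^+ 3) * a.
  rewrite ler_wpM2r; try lra.
  by have : e ^+ 3 <= e; [rewrite exprSr ler_piMl; lra | lra].
have -> : (1 - e ^+ 3) * (a + y)
    = y * (1 - e ^+ 4) + (1 - e ^+ 3) * a - e ^+ 2 * (1 - e) * (e * y) by ring.
lra.
Qed.

End elementary_estimates.

(** * The layers when the reference state is reached in one step *)

Section layers.
Variables (R : realType) (N : nat) (U : 'I_N.+1 -> metricType R).
Variable p : forall i : 'I_N.+1, 'I_N.+1 -> U i -> R.
Hypothesis U_nonempty : forall i, [set: U i] !=set0.

Section eta_bound.
Hypothesis U_compact : forall i, compact [set: U i].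
Hypothesis p_continuous : forall i j, continuous (@p i j).

(** Compactness turns pointwise positivity into a positive infimum, which is
    then one of the numbers over which eta_min is taken. *)
Lemma eta_min_le i j (u : U i) :
  (forall v : U i, 0 < p j v) -> eta_min p <= p j u.
Proof.
move=> p_gt0; have [v [pbarE v_le]] :=
  umin_attained (@U_compact i) (U_nonempty i) (@p_continuous i j).
apply: le_trans (v_le u); rewrite -pbarE; apply: ge_inf.
  by exists 0 => x [k [k' [_ /ltW]]].
by exists i, j; split=> //; rewrite pbarE.
Qed.

End eta_bound.

(** If p(i,n,u) = 0 then the quotient in chi equals 1. *)
Lemma chi_max_lt1_pmax_gt0 (c : forall i, U i -> R) (r : R) i (u : U i) :
  controlled_stochastic p -> chi_max p c r < 1 -> 0 < p ord_max u.
Proof.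
move=> p_stoch chi_lt1.
have p_le1 k (v : U k) : p ord_max v <= 1.
  have [p_ge0 <-] := p_stoch k v.
  by rewrite (bigD1 ord_max)//= lerDl sumr_ge0.
have [p_ge0 _] := p_stoch i u; rewrite lt_neqAle p_ge0 andbT.
apply/negP => /eqP p0; move: chi_lt1; rewrite ltNge => /negP; apply.
set E := expR (cbar c + r); have E_gt0 : 0 < E by exact: expR_gt0.
apply: ub_le_sup; last first.
  by exists i, u; rewrite -p0 subr0 mul1r add0r divff// gt_eqF.
(* The supremum in chi_max is a genuine one, all quotients being at most 1. *)
exists 1 => _ [k [v ->]]; have [q_ge0 _] := p_stoch k v.
have q_le1 := p_le1 k v; have := q_ge0 ord_max.
rewrite -/E; set q := p ord_max v in q_le1 * => {}q_ge0.
have pE_ge0 : 0 <= (1 - q) * E by rewrite mulr_ge0 ?expR_ge0 ?subr_ge0.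
have den_gt0 : 0 < q + (1 - q) * E.
  have [->|q_neq0] := eqVneq q 0; first by lra.
  by rewrite ltr_wpDr// lt_neqAle eq_sym q_neq0.
by rewrite ler_pdivrMr// mul1r lerDr.
Qed.

Variable eta : R.
Hypothesis eta_gt0 : 0 < eta.
Hypothesis pmax_ge : forall i (u : U i), eta <= p ord_max u.

Lemma layer2E : layer p 2 = [set~ ord_max]%SET.
Proof.
apply/setP => i; rewrite !inE/=; case: (i != ord_max) => //=.
apply: (lt_le_trans eta_gt0); have [u0 _] := U_nonempty i.
apply: lb_le_inf; first by eexists; exists u0.
by move=> _ [u _ <-]; rewrite big_set1E le_max pmax_ge.
Qed.

Lemma reached_setT k : (1 < k)%N -> reached p k = [set: 'I_N.+1]%SET.
Proof.
elim: k => [//|[//|[|k]] IH _].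
  have -> : reached p 2 = (reached p 1 :|: layer p 2)%SET by [].
  by rewrite layer2E finset.setUCr.
have -> : reached p k.+3 = (reached p k.+2 :|: layer p k.+3)%SET by [].
by rewrite IH// finset.setTU.
Qed.

Lemma layer_set0 k : (2 < k)%N -> layer p k = finset.set0.
Proof.
case: k => [//|[//|[//|k]]] _; apply/setP => i.
have -> : layer p k.+3 = next_layer p (reached p k.+2) by [].
by rewrite reached_setT// !inE.
Qed.

Lemma l0_eq2 : (0 < N)%N -> l0 p = 2.
Proof.
move=> N_gt0; rewrite /l0.
have -> : [set k : 'I_N.+2 | layer p k != finset.set0]%SET
    = [set inord 1; inord 2]%SET.
  apply/setP => -[k kN]; rewrite !inE -!val_eqE/= !inordK//.
  have ne0 i (A : {set 'I_N.+1}) : i \in A -> A != finset.set0.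
    by move=> iA; apply/set0Pn; exists i.
  case: k kN => [|[|[|k]]] _.
  - by rewrite eqxx.
  - by rewrite (ne0 ord_max)// inE.
  - by rewrite layer2E (ne0 ord0)// !inE -val_eqE/= eq_sym -lt0n.
  - by rewrite layer_set0// eqxx.
by rewrite cards2 -val_eqE/= !inordK.
Qed.

Lemma layer_index_eq2 i : i != ord_max -> layer_index p i = 2.
Proof.
move=> i_neq; have N_gt0 : (0 < N)%N.
  by case: (N) i i_neq => // i; rewrite (ord1 i) -val_eqE.
have iotaE : iota 0 N.+2 = [:: 0, 1, 2 & iota 3 N.-1]%N.
  by rewrite -[in LHS](prednK N_gt0).
have i_in2 : i \in layer p 2 by rewrite layer2E !inE.
by rewrite /layer_index iotaE /= [i \in next_layer _ _]i_in2 !inE (negbTE i_neq).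
Qed.

End layers.

(** * The contraction estimate *)

Section contraction.
Variables (R : realType) (N : nat) (U : 'I_N.+1 -> metricType R).
Variable p : forall i : 'I_N.+1, 'I_N.+1 -> U i -> R.
Variable c : forall i : 'I_N.+1, U i -> R.
Variable delta : R.
Hypothesis U_nonempty : forall i, [set: U i] !=set0.
Hypothesis p_stochastic : controlled_stochastic p.
Hypothesis c_ge0 : forall i (u : U i), 0 <= c u.
Hypothesis delta_ge0 : 0 <= delta.
Variable eta : R.
Hypothesis eta_gt0 : 0 < eta.
Hypothesis pmax_ge : forall i (u : U i), eta <= p ord_max u.

(** The contribution to G at state i of the values that the sweep has not
    updated yet. *)
Definition old_part (h : 'rV[R]_N.+1) (i : 'I_N.+1) (u : U i) : R :=
  \sum_(j < N.+1 | (i <= j < N)%N) expR (h 0 j) * p j u.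

Lemma old_part_ge0 h i (u : U i) : 0 <= old_part h u.
Proof.
by apply: sumr_ge0 => j _; rewrite mulr_ge0 ?expR_ge0//; have [] := p_stochastic u.
Qed.

Lemma old_part_le (h : 'rV[R]_N.+1) (r : R) i (u : U i) :
  (forall j, h 0 j <= r) -> old_part h u <= expR r.
Proof.
move=> h_le; have [p_ge0 p_sum1] := p_stochastic u.
apply: (@le_trans _ _ (\sum_(j < N.+1) expR r * p j u)).
  rewrite /old_part big_mkcond; apply: ler_sum => j _.
  by case: ifP => _; [rewrite ler_wpM2r// ler_expR | rewrite mulr_ge0 ?expR_ge0].
by rewrite -mulr_sumr p_sum1 mulr1.
Qed.

(** Taking the minimum over actions preserves the bound of the fixed-action
    estimate.  The extra discrepancy s is the part of the error at earlier
    states that comes from lambda, while b * d comes from h. *)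
Lemma G_one_state_le (h1 h2 : 'rV[R]_N.+1) (lam1 lam2 b d s : R) (i : 'I_N.+1) :
  0 <= d -> 0 <= s ->
  (forall u : U i, old_part h1 u <= b * (p ord_max u + old_part h1 u)) ->
  (forall j : 'I_N.+1, (j < i)%N ->
    G p c delta h1 lam1 0 j <= G p c delta h2 lam2 0 j + (b * d + s)) ->
  (forall j : 'I_N.+1, (j < N)%N -> h1 0 j <= h2 0 j + d) ->
  G p c delta h1 lam1 0 i
    <= G p c delta h2 lam2 0 i + (b * d + s + `|lam1 - lam2|).
Proof.
move=> d_ge0 s_ge0 margin g_le h_le; rewrite !GE.
have lam_le : lam2 - lam1 <= `|lam1 - lam2| by rewrite distrC ler_norm.
set f1 := (X in umin X - lam1); set f2 := (X in umin X - lam2).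
suff : umin f1 <= umin f2 + (b * d + s) by lra.
have pmax_gt0 (u : U i) : 0 < p ord_max u := lt_le_trans eta_gt0 (pmax_ge u).
(* The costs are nonnegative and the mass at the reference state is at least
   eta, hence the minimized expression is at least ln eta. *)
apply: (@le_uminD _ _ _ _ (ln eta)) => // u.
  have new_ge0 : 0 <= \sum_(j < N.+1 | (j < i)%N) expR (G p c delta h1 lam1 0 j) * p j u.
    apply: sumr_ge0 => j _.
    by rewrite mulr_ge0 ?expR_ge0//; have [] := p_stochastic u.
  rewrite /f1 -[leLHS]add0r lerD ?mulr_ge0// ler_ln ?posrE//.
    by rewrite -addrA ler_wpDr// addr_ge0//; exact: old_part_ge0.
  by rewrite -addrA ltr_wpDr// addr_ge0//; exact: old_part_ge0.
rewrite /f1 /f2 -[leRHS]addrA lerD2l; apply: (@ln_sum_expR_contract _ _ _ _ _ _ _ _ _ _ b d) => //.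
- by have [] := p_stochastic u.
- by rewrite lerDl.
- by move=> j /andP[_ /h_le].
- exact: margin.
Qed.

Variable m : R.

(** The first state falls under the same recursion as the others, the maximum
    over an empty range being 0. *)
Lemma Delta_vec_weight i : 0 < weight p m i ->
  weight p m i * Delta_vec p m 0 i
    = 1 + \big[Num.max/0]_(j < N.+1 | (j < i)%N) Delta_vec p m 0 j.
Proof.
move=> w_gt0; have w_neq0 := lt0r_neq0 w_gt0; rewrite Delta_vecE mulrC.
case: eqVneq => [i0|_]; last by rewrite divfK.
by rewrite divfK// big_pred0 ?addr0// => j; rewrite i0 ltn0.
Qed.

(** The earlier states used at state i are never the reference state, so their
    weight is the smallest one, w; this leaves room for the bound at i,
    whose weight is w or 1.  The bound is one-sided; the norm estimate follows by
    exchanging the two arguments. *)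
Lemma G_weighted_le (w b H : R) (h1 h2 : 'rV[R]_N.+1) (lam1 lam2 : R) (i : 'I_N.+1) :
  0 < w -> w <= 1 -> (forall j, j != ord_max -> weight p m j = w) ->
  0 <= b -> 0 <= H ->
  (forall j (u : U j), old_part h1 u <= b * (p ord_max u + old_part h1 u)) ->
  (forall j, h1 0 j - h2 0 j <= weight p m j * H) ->
  G p c delta h1 lam1 0 i - G p c delta h2 lam2 0 i
    <= weight p m i * (b * H + Delta_vec p m 0 i * `|lam1 - lam2|).
Proof.
move=> w_gt0 w_le1 weightE b_ge0 H_ge0 margin h_le.
have w_le j : w <= weight p m j.
  by have [->|/weightE->//] := eqVneq j ord_max; rewrite /weight eqxx.
have [k] := ubnP (i : nat); elim: k i => // k IH i /ltnSE ik.
have weight_gt0 := lt_le_trans w_gt0 (w_le i).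
have ltN_neq (j : 'I_N.+1) : (j < N)%N -> j != ord_max.
  by move=> jN; rewrite -val_eqE/= ltn_eqF.
set M := \big[Num.max/0]_(j < N.+1 | (j < i)%N) Delta_vec p m 0 j.
have M_ge0 : 0 <= M by exact: bigmax_ge_id.
(* M |lam1 - lam2| dominates the lambda-error w Delta_j |lam1 - lam2| of each
   earlier state j, as w <= 1. *)
have step := @G_one_state_le h1 h2 lam1 lam2 b (w * H) (M * `|lam1 - lam2|) i.
rewrite mulrDr [_ * (Delta_vec _ _ _ _ * _)]mulrA Delta_vec_weight// -/M lerBlDl.
have bH_ge0 : 0 <= b * H by rewrite mulr_ge0.
have := ler_wpM2r bH_ge0 (w_le i).
suff : G p c delta h1 lam1 0 i <= G p c delta h2 lam2 0 i
    + (b * (w * H) + M * `|lam1 - lam2| + `|lam1 - lam2|) by lra.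
apply: step => //; rewrite ?mulr_ge0 ?(ltW w_gt0)// => j ji; last first.
  by have := h_le j; rewrite weightE ?ltN_neq//; lra.
have := IH j (leq_trans ji ik).
rewrite weightE; last by apply: ltN_neq; rewrite (leq_trans ji)// -ltnS.
have D_le : w * Delta_vec p m 0 j <= M.
  apply: (@le_trans _ _ (w * M)); last by rewrite ler_piMl.
  by rewrite ler_pM2l// le_bigmax_cond.
have := ler_wpM2r (normr_ge0 (lam1 - lam2)) D_le; lra.
Qed.

End contraction.

Theorem proposition4p3 (R : realType) (N : nat)
    (U : 'I_N.+1 -> metricType R)
    (p : forall i : 'I_N.+1, 'I_N.+1 -> U i -> R)
    (c : forall i : 'I_N.+1, U i -> R)
    (delta : R)
    (U_nonempty : forall i, [set: U i] !=set0)
    (U_compact : forall i, compact [set: U i])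
    (p_stochastic : controlled_stochastic p)
    (c_ge0 : forall i (u : U i), 0 <= c i u)
    (delta_gt0 : 0 < delta)
    (c_continuous : forall i, continuous (c i))
    (p_continuous : forall i j, continuous (p i j))
    (p_irreducible : forall v : (forall i, U i), irreducible_mx (policy_mx p v))
    (eta_in01 : 0 < eta_min p < 1)
    (etabar_in01 : 0 < etabar p < 1)
    (chi_lt1 : forall r : R, 0 < r -> chi_max p c r < 1)
    (lam1 lam2 l : R)
    (lam1_Lambda : Lambda p c delta lam1)
    (lam2_Lambda : Lambda p c delta lam2)
    (l_gt0 : 0 < l)
    (h1 h2 : 'rV[R]_N.+1)
    (h1_le : `|h1| <= l)
    (h2_le : `|h2| <= l) :
  let L := Num.max `|lam1| `|lam2| in
  let m := (cbar c + l + L) *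
    Num.max (1 / (1 - etabar p))
            ((1 - chi_max p c (l + L) ^+ N) / (1 - chi_max p c (l + L))) in
  wnorm p m (G p c delta h1 lam1 - G p c delta h2 lam2)
    <= beta_coef p m * wnorm p m (h1 - h2) + Delta p m * `|lam1 - lam2|.
Proof.
have eta_gt0 : 0 < eta_min p by case/andP: eta_in01.
have pmax_gt0 i (u : U i) : 0 < p i ord_max u.
  exact: chi_max_lt1_pmax_gt0 p_stochastic (chi_lt1 1 ltr01).
have pmax_ge i (u : U i) : eta_min p <= p i ord_max u.
  by apply: eta_min_le => //; apply: pmax_gt0.
have N_gt0 : (0 < N)%N.
  rewrite lt0n; apply/negP => /eqP N0; move: etabar_in01.
  have NR0 : N%:R = 0 :> R by rewrite N0.
  by rewrite /etabar NR0 mul0r subr0 ltxx andbF.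
lazy zeta; set L := Num.max _ _; set m := _ * Num.max _ _.
have L_ge0 : 0 <= L by rewrite le_max normr_ge0.
have cbar_ge0 : 0 <= cbar c.
  by apply: sup_nonneg => _ [i [u ->]]; exact: c_ge0.
(* Both factors of m matter: the first is at least l, the second at least
   1 / (1 - etabar) > 1. *)
have l_le_m : l <= m.
  apply: (@le_trans _ _ (cbar c + l + L)); first by lra.
  rewrite ler_peMr//; first by lra.
  rewrite le_max; apply/orP; left; move/andP: etabar_in01 => [eb_gt0 eb_lt1].
  by rewrite ler_pdivlMr; lra.
set e := eta_min p * expR (- 2 * m).
have e_gt0 : 0 < e by rewrite mulr_gt0 ?expR_gt0.
have e_lt1 : e < 1.
  have E_le1 : expR (- 2 * m) <= 1 by rewrite expR_le1; lra.
  by case/andP: eta_in01 => _; apply: le_lt_trans; rewrite ler_piMr// ltW.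
have weightE j : j != ord_max -> weight p m j = 1 - e ^+ 4.
  move=> j_neq; rewrite /weight (negbTE j_neq).
  by rewrite (layer_index_eq2 U_nonempty eta_gt0 pmax_ge).
have w_gt0 : 0 < 1 - e ^+ 4 by rewrite subr_gt0 exprn_ilt1 ?ltW.
have w_le1 : 1 - e ^+ 4 <= 1 by rewrite gerBl exprn_ge0 ?ltW.
have betaE : beta_coef p m = (1 - e ^+ 3) / (1 - e ^+ 4).
  by rewrite /beta_coef (l0_eq2 U_nonempty eta_gt0 pmax_ge).
have beta_ge0 : 0 <= beta_coef p m.
  by rewrite betaE divr_ge0 ?ltW// subr_gt0 exprn_ilt1 ?ltW.
have weight_gt0 j : 0 < weight p m j.
  by have [->|/weightE->//] := eqVneq j ord_max; rewrite /weight eqxx.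
set H := wnorm p m (h1 - h2).
have H_ge0 : 0 <= H by exact: bigmax_ge_id.
have h_le j : `|h1 0 j - h2 0 j| <= weight p m j * H.
  rewrite mulrC -ler_pdivrMr//.
  by have := le_bigmax 0 (fun i => `|(h1 - h2) 0 i| / weight p m i) j; rewrite !mxE.
have coord_le (h : 'rV[R]_N.+1) j : `|h| <= l -> h 0 j <= m.
  move=> h_le_l; apply: le_trans (ler_norm _) (le_trans _ l_le_m).
  apply: le_trans h_le_l; rewrite [leRHS]/Num.Def.normr/= mx_normrE.
  exact: (le_bigmax 0 (fun ij => `|h ij.1 ij.2|) (0, j)).
have G_le (k1 k2 : 'rV[R]_N.+1) mu1 mu2 i : `|k1| <= l ->
    (forall j, `|k1 0 j - k2 0 j| <= weight p m j * H) ->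
    G p c delta k1 mu1 0 i - G p c delta k2 mu2 0 i
      <= weight p m i * (beta_coef p m * H + Delta_vec p m 0 i * `|mu1 - mu2|).
  move=> k1_le k_le.
  apply: (G_weighted_le U_nonempty p_stochastic c_ge0 (ltW delta_gt0) eta_gt0 pmax_ge
      (w := 1 - e ^+ 4)) => // [j u|j]; last exact: le_trans (ler_norm _) (k_le j).
  rewrite betaE; apply: (@gauss_seidel_margin _ (eta_min p) m) => //.
  - exact: old_part_ge0.
  - by apply: old_part_le => // j'; exact: coord_le.
  - by apply: le_trans (ltW l_gt0) l_le_m.
apply: bigmax_le => [|i _].
  by rewrite addr_ge0// mulr_ge0// bigmax_ge_id.
have subE (x y : 'rV[R]_N.+1) : (x - y) 0 i = x 0 i - y 0 i by rewrite !mxE.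
rewrite ler_pdivrMr// mulrC subE.
apply: (@le_trans _ _
    (weight p m i * (beta_coef p m * H + Delta_vec p m 0 i * `|lam1 - lam2|))).
  have G12 := G_le h1 h2 lam1 lam2 i h1_le h_le.
  have h_le' j : `|h2 0 j - h1 0 j| <= weight p m j * H by rewrite distrC.
  have G21 := G_le h2 h1 lam2 lam1 i h2_le h_le'.
  by rewrite ler_norml G12 andbT lerNl opprB [`|lam1 - lam2|]distrC.
by rewrite ler_pM2l// lerD2l ler_wpM2r// le_bigmax.
Qed.
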